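(* Let $n\ge 1$ be an integer, let $L$ be a finite von Neumann algebra with a fixed faithful normal tracial state $\tau_L$, let $M = M_n(\mathbb{C})\otimes L$ and $\tau = \frac{\mathrm{Tr}}{n}\otimes \tau_L$. Let $N = M_n(\mathbb{C})\otimes 1_L \subset M$ and let $u\in M$ be a unitary operator. Let $U$ be the finite operational partition of unity (in $L$, of size $n^2$) induced by $u$, and let $\rho[U]$ be the associated $n^2\times n^2$ density matrix with respect to $\tau_L$. Then the following conditions are equivalent: (1) $N$ and $uNu^*$ are mutually orthogonal (with respect to $\tau$); (2) $n^2\rho[U]$ is the $n^2\times n^2$ identity matrix; (3) $S(\rho[U]) = 2\log n = \log \dim N$.
   Context: Von Neumann algebras act on separable Hilbert spaces. $\mathrm{Tr}$ is the standard trace on a full matrix algebra, with $\mathrm{Tr}(p)=1$ for every minimal projection $p$. A von Neumann subalgebra of $M$ is a $*$-subalgebra closed in the weak operator topology containing the unit of $M$. Mutual orthogonality: for a finite von Neumann algebra $M$ with faithful normal tracial state $\tau$, and a von Neumann subalgebra $A$, let $E_A:M\to A$ be the unique faithful normal conditional expectation with $\tau(xa)=\tau(E_A(x)a)$ for $x\in M$, $a\in A$. Two von Neumann subalgebras $A,B$ of $M$ are mutually orthogonal (also called complementary) if one of the following conditions, which are known to be equivalent, holds: (i) $\tau(ab)=0$ for all $a\in A$, $b\in B$ with $\tau(a)=\tau(b)=0$; (ii) $\tau(ab)=\tau(a)\tau(b)$ for all $a\in A$, $b\in B$; (iii) $\|ab\|_\tau=\|a\|_\tau\|b\|_\tau$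 for all $a\in A$, $b\in B$, where $\|x\|_\tau=\tau(x^*x)^{1/2}$; (iv) $E_AE_B(x)=\tau(x)1_M$ for all $x\in M$; (v) $E_A(B)\subset\mathbb{C}1_M$. Finite operational partition of unity of size $k$ in a unital $C^*$-algebra $A$: a family $X=\{x_1,\dots,x_k\}\subset A$ with $\sum_{i=1}^k x_i^*x_i=1_A$. For a state $\phi$ of $A$, $\rho_\phi[X]$ is the $k\times k$ density matrix (positive semidefinite matrix of trace $\mathrm{Tr}=1$) with $(i,j)$-entry $\phi(x_j^*x_i)$; when $A$ is a finite von Neumann algebra with given tracial state $\tau_A$, write $\rho[X]=\rho_{\tau_A}[X]$. Partition induced by $u$: let $\{e_{ij}\}_{i,j=1}^n$ be a system of matrix units of $M_n(\mathbb{C})$ and write $u=\sum_{i,j=1}^n e_{ij}\otimes u_{ij}$ with $u_{ij}\in L$. Then $U=\{\frac{1}{\sqrt n}u_{ij} : i,j=1,\dots,n\}$, regarded as a family numbered as $u_1,\dots,u_{n^2}$ by $u_i=\frac{1}{\sqrt n}u_{i-kn,\,k+1}$ when $kn+1\le i\le (k+1)n$, $k\in\{0,\dots,n-1\}$. It is a finite operational partition of unity of size $n^2$ in $L$, and $\rho[U]$ has entries $\tau_L(u_j^*u_i)$. Von Neumann entropy of a density matrix $\rho$: $S(\rho)=\mathrm{Tr}(\eta(\rho))$ where $\eta(t)=-t\log t$ for $0<t\le 1$ and $\eta(0)=0$. *)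

(* Defs.v *)
From HB Require Import structures.
From mathcomp Require Import all_boot all_order all_algebra.
From mathcomp Require Import complex.
From mathcomp Require Import all_classical all_reals all_analysis.

Set Implicit Arguments.
Unset Strict Implicit.
Unset Printing Implicit Defensive.

Import Order.TTheory GRing.Theory Num.Theory.
Import numFieldNormedType.Exports.

Local Open Scope classical_set_scope.
Local Open Scope ring_scope.
Local Open Scope complex_scope.
Local Open Scope sesquilinear_scope.

(* The inner product is linear in its first argument. *)
Record sepHilbert (R : realType) := SepHilbert {
  hspace :> completeNormedModType R[i];
  hdot : {dot hspace for Num.Def.conjC};
  hdot_norm : forall x : hspace, `|x| ^+ 2 = hdot x x;
  hspace_separable : exists2 S : set hspace, countable S & dense S }.

Record bop (R : realType) (H : sepHilbert R) := BOp {
  bop_fun :> H -> H;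
  bop_linear : linear bop_fun;
  bop_bounded : exists k : R[i], forall x, `|bop_fun x| <= k * `|x| }.

Section BoundedOperators.
Variables (R : realType) (H : sepHilbert R).
Implicit Types (S T U : bop H) (a : R[i]).

Lemma bopP S T : (forall x, S x = T x) -> S = T.
Proof.
case: S T => [f fl fb] [g gl gb] /= fg.
have e : f = g by apply/funext.
subst g; congr BOp; exact: Prop_irrelevance.
Qed.

HB.instance Definition _ := gen_eqMixin (bop H).
HB.instance Definition _ := gen_choiceMixin (bop H).

Fact bop0_linear : linear (fun _ : H => 0 : H).
Proof. by move=> a x y; rewrite scaler0 addr0. Qed.
Fact bop0_bounded : exists k : R[i], forall x : H, `|0 : H| <= k * `|x|.
Proof. by exists 0 => x; rewrite normr0 mul0r. Qed.
Definition bop0 := BOp bop0_linear bop0_bounded.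

Fact bop1_linear : linear (fun x : H => x).
Proof. by []. Qed.
Fact bop1_bounded : exists k : R[i], forall x : H, `|x| <= k * `|x|.
Proof. by exists 1 => x; rewrite mul1r. Qed.
Definition bop1 := BOp bop1_linear bop1_bounded.

Fact bop_scale_linear a T : linear (fun x => a *: T x).
Proof.
by move=> b x y; rewrite bop_linear scalerDr !scalerA (mulrC a b).
Qed.
Fact bop_scale_bounded a T :
  exists k : R[i], forall x, `|a *: T x| <= k * `|x|.
Proof.
have [k Tk] := bop_bounded T; exists (`|a| * k) => x.
by rewrite normrZ -mulrA ler_wpM2l.
Qed.
Definition bop_scale a T :=
  BOp (@bop_scale_linear a T) (bop_scale_bounded a T).

Fact bop_add_linear S T : linear (fun x => S x + T x).
Proof. by move=> a x y; rewrite !bop_linear scalerDr addrACA. Qed.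
Fact bop_add_bounded S T :
  exists k : R[i], forall x, `|S x + T x| <= k * `|x|.
Proof.
have [k Sk] := bop_bounded S; have [l Tl] := bop_bounded T.
exists (k + l) => x; apply: le_trans (ler_normD _ _) _.
by rewrite mulrDl lerD.
Qed.
Definition bop_add S T := BOp (@bop_add_linear S T) (bop_add_bounded S T).

Definition bop_opp T := bop_scale (-1) T.

Fact bop_mul_linear S T : linear (fun x => S (T x)).
Proof. by move=> a x y; rewrite !bop_linear. Qed.
Fact bop_mul_bounded S T :
  exists k : R[i], forall x, `|S (T x)| <= k * `|x|.
Proof.
have [k Sk] := bop_bounded S; have [l Tl] := bop_bounded T.
have Sk' y : `|S y| <= `|k| * `|y|.
  have kr : k * `|y| \is Num.real.
    by apply: ger0_real; exact: le_trans (Sk y).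
  apply: le_trans (Sk y) _; apply: le_trans (real_ler_norm kr) _.
  by rewrite normrM normr_id.
exists (`|k| * l) => x; apply: le_trans (Sk' _) _.
by rewrite -mulrA ler_wpM2l.
Qed.
Definition bop_mul S T := BOp (@bop_mul_linear S T) (bop_mul_bounded S T).

Fact bop_addA : associative bop_add.
Proof. by move=> S T U; apply: bopP => x /=; rewrite addrA. Qed.
Fact bop_addC : commutative bop_add.
Proof. by move=> S T; apply: bopP => x /=; rewrite addrC. Qed.
Fact bop_add0 : left_id bop0 bop_add.
Proof. by move=> T; apply: bopP => x /=; rewrite add0r. Qed.
Fact bop_addN : left_inverse bop0 bop_opp bop_add.
Proof. by move=> T; apply: bopP => x /=; rewrite scaleN1r addNr. Qed.
HB.instance Definition _ :=
  GRing.isZmodule.Build (bop H) bop_addA bop_addC bop_add0 bop_addN.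

Fact bop_scaleA a b T : bop_scale a (bop_scale b T) = bop_scale (a * b) T.
Proof. by apply: bopP => x /=; rewrite scalerA. Qed.
Fact bop_scale1 : left_id 1 bop_scale.
Proof. by move=> T; apply: bopP => x /=; rewrite scale1r. Qed.
Fact bop_scaleDr : right_distributive bop_scale +%R.
Proof. by move=> a S T; apply: bopP => x /=; rewrite scalerDr. Qed.
Fact bop_scaleDl T : {morph bop_scale^~ T : a b / a + b}.
Proof. by move=> a b; apply: bopP => x /=; rewrite scalerDl. Qed.
HB.instance Definition _ := GRing.Zmodule_isLmodule.Build R[i] (bop H)
  bop_scaleA bop_scale1 bop_scaleDr bop_scaleDl.

Fact bop_mulA : associative bop_mul.
Proof. by move=> S T U; apply: bopP. Qed.
Fact bop_mul1 : left_id bop1 bop_mul.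
Proof. by move=> T; apply: bopP. Qed.
Fact bop_mulr1 : right_id bop1 bop_mul.
Proof. by move=> T; apply: bopP. Qed.
Fact bop_mulDl : left_distributive bop_mul +%R.
Proof. by move=> S T U; apply: bopP. Qed.
Fact bop_mulDr : right_distributive bop_mul +%R.
Proof.
move=> S T U; apply: bopP => x /=.
by have := bop_linear S 1 (T x) (U x); rewrite !scale1r.
Qed.
HB.instance Definition _ := GRing.Zmodule_isPzRing.Build (bop H)
  bop_mulA bop_mul1 bop_mulr1 bop_mulDl bop_mulDr.

Definition is_adjoint T S := forall x y, hdot H (T x) y = hdot H x (S y).

(* The adjoint of T: it is unique, and exists by the Riesz theorem. *)
Definition adj T : bop H := xget 0 [set S | is_adjoint T S].

Definition op_le S T := forall x, 0 <= hdot H ((T - S) x) x.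

Definition wot_closed (A : set (bop H)) :=
  forall T : bop H,
    (forall (s : seq (H * H)) (eps : R[i]), 0 < eps ->
       exists2 S, A S &
         forall p, p \in s -> `|hdot H ((T - S) p.1) p.2| < eps) ->
    A T.

Record von_neumann_algebra (A : set (bop H)) : Prop := VonNeumannAlgebra {
  vna_unit : A 1;
  vna_lin : forall a S T, A S -> A T -> A (a *: S + T);
  vna_mul : forall S T, A S -> A T -> A (S * T);
  vna_adj : forall T, A T -> exists2 S, A S & is_adjoint T S;
  vna_wot_closed : wot_closed A }.

(* 1 is a finite projection: every isometry of A is unitary. *)
Definition finite_vna (A : set (bop H)) :=
  forall v, A v -> adj v * v = 1 -> v * adj v = 1.

(* tau preserves suprema of bounded upward directed families in A_+; the
   suprema on the right are taken in R[i], ordered by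
   z <= w iff w - z is a nonnegative real. *)
Definition normal_functional (A : set (bop H)) (tau : bop H -> R[i]) :=
  forall (D : set (bop H)) (T : bop H),
    D `<=` A -> D !=set0 ->
    (forall S, D S -> op_le 0 S) ->
    (forall S1 S2, D S1 -> D S2 ->
       exists2 S, D S & op_le S1 S /\ op_le S2 S) ->
    A T -> (forall S, D S -> op_le S T) ->
    (forall T', A T' -> (forall S, D S -> op_le S T') -> op_le T T') ->
    supremums (tau @` D) (tau T).

(* Functionals on A are represented by functions on B(H) whose values
   outside A are irrelevant. *)
Record faithful_normal_tracial_state (A : set (bop H))
    (tau : bop H -> R[i]) : Prop := FaithfulNormalTracialState {
  trace_lin : forall a S T, A S -> A T ->
    tau (a *: S + T) = a * tau S + tau T;
  trace_pos : forall T, A T -> 0 <= tau (adj T * T);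
  trace_unit : tau 1 = 1;
  trace_tracial : forall S T, A S -> A T -> tau (S * T) = tau (T * S);
  trace_faithful : forall T, A T -> tau (adj T * T) = 0 -> T = 0;
  trace_normal : normal_functional A tau }.

(* Operators on C^n (x) H are n x n matrices over B(H); a (x) T has entries
   a_ij T. *)
Definition tens n (a : 'M[R[i]]_n) (T : bop H) : 'M[bop H]_n :=
  \matrix_(i, j) (a i j *: T).

(* As M_n(C) is finite-dimensional, the tensor product with L needs no
   completion. *)
Definition tensor_algebra n (L : set (bop H)) : set 'M[bop H]_n :=
  [set x | exists m (a : 'I_m -> 'M[R[i]]_n) (T : 'I_m -> bop H),
     (forall k, L (T k)) /\ x = \sum_(k < m) tens (a k) (T k)].

(* Tr/n (x) tau: on a (x) T with T in L it is (\tr a / n) * tau T. *)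
Definition tens_trace n (tau : bop H -> R[i]) (x : 'M[bop H]_n) : R[i] :=
  n%:R^-1 * \sum_(i < n) tau (x i i).

Definition adjmx n (x : 'M[bop H]_n) : 'M[bop H]_n :=
  \matrix_(i, j) adj (x j i).

Definition unitary_op n (u : 'M[bop H]_n) :=
  adjmx u *m u = 1%:M /\ u *m adjmx u = 1%:M.

Definition mx_factor n : set 'M[bop H]_n :=
  [set tens a 1 | a in [set: 'M[R[i]]_n]].

Definition conj_set n (u : 'M[bop H]_n) (A : set 'M[bop H]_n) :=
  [set u *m x *m adjmx u | x in A].

Definition mutually_orthogonal n (t : 'M[bop H]_n -> R[i])
    (A B : set 'M[bop H]_n) :=
  forall a b : 'M[bop H]_n, A a -> B b -> t a = 0 -> t b = 0 -> t (a *m b) = 0.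

Definition lincomb n d (b : 'I_d -> 'M[bop H]_n) (c : {ffun 'I_d -> R[i]}) :=
  \sum_(k < d) map_mx ( *:%R (c k)) (b k).

(* A is a complex vector space with a basis of d elements. *)
Definition has_dim n (A : set 'M[bop H]_n) (d : nat) :=
  exists2 b : 'I_d -> 'M[bop H]_n,
    injective (lincomb b) & A = range (lincomb b).

End BoundedOperators.

Definition matrix_units (R : realType) n (e : 'I_n -> 'I_n -> 'M[R[i]]_n) :=
  [/\ forall i j k l, e i j *m e k l = (j == k)%:R *: e i l,
      forall i j, (e i j)^t* = e j i &
      \sum_(i < n) e i i = 1%:M].

Fact col_index_subproof n (m : 'I_(n ^ 2)) : (m %/ n < n)%N.
Proof.
case: n m => [|n] [m mn] //=; by rewrite ltn_divLR // -[X in (_ < X)%N]mulnn.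
Qed.
Fact row_index_subproof n (m : 'I_(n ^ 2)) : (m %% n < n)%N.
Proof. by case: n m => [|n] [m mn] //=; rewrite ltn_pmod. Qed.
Definition col_index n (m : 'I_(n ^ 2)) : 'I_n := Ordinal (col_index_subproof m).
Definition row_index n (m : 'I_(n ^ 2)) : 'I_n := Ordinal (row_index_subproof m).

(* Columnwise numbering: with indices starting at 0, member k * n + r is
   u_{r,k} / sqrt n. *)
Definition induced_partition (R : realType) (H : sepHilbert R) n
    (u : 'I_n -> 'I_n -> bop H) (m : 'I_(n ^ 2)) : bop H :=
  (sqrtC (n%:R : R[i]))^-1 *: u (row_index m) (col_index m).

Definition density_mx (R : realType) (H : sepHilbert R) k
    (phi : bop H -> R[i]) (X : 'I_k -> bop H) : 'M[R[i]]_k :=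
  \matrix_(i, j) phi (adj (X j) * X i).

(* Functional calculus f(A) for a Hermitian matrix A. *)
Definition mx_fun (R : realType) k (f : R -> R) (A : 'M[R[i]]_k) : 'M[R[i]]_k :=
  invmx (spectralmx A)
  *m diag_mx (map_mx (fun z => (f (complex.Re z))%:C) (spectral_diag A))
  *m spectralmx A.

(* Density matrices have spectrum in [0, 1]; eta is only used there. *)
Definition eta (R : realType) (t : R) : R := if 0 < t then - t * ln t else 0.

Definition entropy (R : realType) k (rho : 'M[R[i]]_k) : R[i] :=
  \tr (mx_fun (@eta R) rho).

(* Main.v *)
Require Import Defs.
From mathcomp Require Import all_boot all_order all_algebra.
From mathcomp Require Import complex ring lra.
From mathcomp Require Import all_classical all_reals all_analysis.

Import Order.TTheory GRing.Theory Num.Theory.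
Import numFieldNormedType.Exports.

Local Open Scope classical_set_scope.
Local Open Scope ring_scope.
Local Open Scope complex_scope.
Local Open Scope sesquilinear_scope.

(** Write N for the matrix factor and tau_n for the trace on the tensor product.

    Orthogonality and the density matrix are two readings of one array of
    numbers, the correlation form B(x, y) = tau_n((x (x) 1) u (y (x) 1) u^* ) on
    pairs of complex matrices. As conjugation by u preserves the trace and the
    unit, B(x, 1) and B(1, x) are both the normalized trace of x; subtracting
    their traces from x and y then shows that N and u N u^* are mutually
    orthogonal iff B(x, y) is always the product of the normalized traces of x
    and y ([mutually_orthogonalP]). Both sides being bilinear, this need only be
    tested on the matrix units, which span ([matrix_units_expand],
    [matrix_units_ext]). There the four matrix units around u and u^* select a
    single product, so that B(e_ab, e_cd) = tau_L(u_bc u_ad^* ) / n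
    ([correlation_matrix_units]); by traciality this is the entry of rho at the
    pairs (b, c) and (a, d) ([density_induced]), while the product of the
    normalized traces is 1 / n^2 if a = b and c = d, and 0 otherwise, which is
    the corresponding entry of 1 / n^2 times the identity.

    The entropy condition concerns any positive matrix A of size k and trace 1.
    Its spectrum is a probability vector p, its entropy is the sum of the
    eta(p_i), and eta lies strictly below its tangent at 1 / k except at the
    point of contact. Summing the tangent inequalities gives entropy at most
    ln k, with equality only if every p_i is 1 / k, that is if A is the
    identity divided by k ([entropy_max]). For rho, k is n^2: positivity is that
    of the trace ([density_mx_psd]), and the trace of rho is B(1, 1) = 1
    ([trace_density]). Finally N has dimension n^2 because the scalar multiples
    of the unit of L form a copy of C ([mx_factor_dim]). *)

Set Implicit Arguments.
Unset Strict Implicit.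

(** * Adjoints of bounded operators *)

Section Adjoints.
Context {R : realType} {H : sepHilbert R}.
Implicit Types (S T : bop H) (a b : R[i]).

Let dotlin a (x y z : H) :
  hdot H (a *: x + y) z = a * hdot H x z + hdot H y z.
Proof. by rewrite linearDl linearZl_LR. Qed.

Let dotsemilin a (x y z : H) :
  hdot H x (a *: y + z) = Num.conj a * hdot H x y + hdot H x z.
Proof. by rewrite linearDr linearZr_LR. Qed.

Lemma is_adjoint_uniq T S1 S2 : is_adjoint T S1 -> is_adjoint T S2 -> S1 = S2.
Proof.
move=> T1 T2; apply: bopP => y; apply/eqP; rewrite -subr_eq0.
rewrite -(dnorm_eq0 (hdot H)) -[X in hdot H _ X]addrC -scaleN1r dotsemilin.
by rewrite -T1 -T2 rmorphN1 mulN1r addNr.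
Qed.

Lemma adj_eq T S : is_adjoint T S -> adj T = S.
Proof.
move=> TS; apply: (@is_adjoint_uniq T) => //.
by rewrite /adj; case: xgetP => [U _ //|/(_ S)/(_ TS)].
Qed.

Lemma is_adjoint_lin a S S' T T' : is_adjoint S S' -> is_adjoint T T' ->
  is_adjoint (a *: S + T) (Num.conj a *: S' + T').
Proof.
move=> SS TT x y /=.
by rewrite dotlin dotsemilin conjCK SS TT.
Qed.

Lemma bop_mulZZ a b S T : (a *: S) * (b *: T) = (a * b) *: (S * T).
Proof.
apply: bopP => x /=; rewrite -scalerA; congr (_ *: _).
have S0 : S 0 = 0.
  by have := bop_linear S (-1) 0 0; rewrite !scaleN1r oppr0 addr0 addNr.
by have := bop_linear S b (T x) 0; rewrite !addr0 S0 addr0.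
Qed.

End Adjoints.

(** * Linearity of the adjoint and of the trace on the algebra *)

Section VonNeumann.
Context {R : realType} {H : sepHilbert R} {L : set (bop H)}.
Hypothesis hL : von_neumann_algebra L.
Implicit Types (S T : bop H) (a : R[i]).

Lemma vna0 : L 0.
Proof.
have := vna_lin hL (-1) (vna_unit hL) (vna_unit hL).
by rewrite scaleN1r addNr.
Qed.

Lemma vnaZ a T : L T -> L (a *: T).
Proof. by move=> LT; rewrite -[_ *: _]addr0; apply: (vna_lin hL) => //; exact: vna0. Qed.

Lemma vnaD S T : L S -> L T -> L (S + T).
Proof. by move=> LS LT; rewrite -[S]scale1r; exact: (vna_lin hL). Qed.

Lemma vna_sum I (r : seq I) (P : pred I) (F : I -> bop H) :
  (forall i, P i -> L (F i)) -> L (\sum_(i <- r | P i) F i).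
Proof. by move=> LF; elim/big_ind: _ => //; [exact: vna0|exact: vnaD]. Qed.

(** [adj T] is defined by choice, with junk value 0 when no adjoint exists;
    within a von Neumann algebra the adjoint is always there. *)
Lemma vna_adjP T : L T -> is_adjoint T (adj T).
Proof. by move=> /(vna_adj hL)[S LS TS]; rewrite (adj_eq TS). Qed.

Lemma vna_adjL T : L T -> L (adj T).
Proof. by move=> /(vna_adj hL)[S LS TS]; rewrite (adj_eq TS). Qed.

Lemma adj_lin a S T : L S -> L T -> adj (a *: S + T) = Num.conj a *: adj S + adj T.
Proof. by move=> LS LT; apply/adj_eq/is_adjoint_lin; exact: vna_adjP. Qed.

Lemma adj0 : adj 0 = 0 :> bop H.
Proof.
by apply: adj_eq => x y /=; rewrite linear0r -(scale0r (0 : H)) linearZl_LR /= mul0r.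
Qed.

Lemma adjZ a T : L T -> adj (a *: T) = Num.conj a *: adj T.
Proof.
move=> LT; rewrite -[_ *: T]addr0 adj_lin ?adj0 ?addr0 //; exact: vna0.
Qed.

Lemma adjD S T : L S -> L T -> adj (S + T) = adj S + adj T.
Proof.
by move=> LS LT; rewrite -[S in LHS]scale1r adj_lin // conjC1 scale1r.
Qed.

Lemma adj_sum I (r : seq I) (P : pred I) (F : I -> bop H) :
  (forall i, P i -> L (F i)) ->
  adj (\sum_(i <- r | P i) F i) = \sum_(i <- r | P i) adj (F i).
Proof.
move=> LF; suff [] : L (\sum_(i <- r | P i) F i) /\
  adj (\sum_(i <- r | P i) F i) = \sum_(i <- r | P i) adj (F i) by [].
elim/big_rec2: _ => [|i T1 T2 Pi [L2 <-]]; first by split; [exact: vna0|exact: adj0].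
by split; [exact: vnaD (LF i Pi) L2|rewrite adjD //; exact: LF].
Qed.

Context {tau : bop H -> R[i]}.
Hypothesis htau : faithful_normal_tracial_state L tau.

Lemma trace0 : tau 0 = 0.
Proof.
have := trace_lin htau (-1) (vna_unit hL) (vna_unit hL).
by rewrite scaleN1r addNr mulN1r addNr.
Qed.

Lemma traceZ a T : L T -> tau (a *: T) = a * tau T.
Proof.
move=> LT; rewrite -[_ *: T]addr0 (trace_lin htau) ?trace0 ?addr0 //; exact: vna0.
Qed.

Lemma traceD S T : L S -> L T -> tau (S + T) = tau S + tau T.
Proof.
by move=> LS LT; rewrite -[S in LHS]scale1r (trace_lin htau) // mul1r.
Qed.

Lemma trace_sum I (r : seq I) (P : pred I) (F : I -> bop H) :
  (forall i, P i -> L (F i)) ->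
  tau (\sum_(i <- r | P i) F i) = \sum_(i <- r | P i) tau (F i).
Proof.
move=> LF; suff [] : L (\sum_(i <- r | P i) F i) /\
  tau (\sum_(i <- r | P i) F i) = \sum_(i <- r | P i) tau (F i) by [].
elim/big_rec2: _ => [|i T1 T2 Pi [L2 <-]]; first by split; [exact: vna0|exact: trace0].
by split; [exact: vnaD (LF i Pi) L2|rewrite traceD //; exact: LF].
Qed.

(** The quadratic form at [v] is [tau (adj y * y)], where [y] is the linear
    combination of the [X i] with coefficients [v]. *)
Lemma density_mx_psd k (X : 'I_k -> bop H) (v : 'rV[R[i]]_k) :
  (forall i, L (X i)) -> 0 <= (v *m density_mx tau X *m v^t*) 0 0.
Proof.
move=> LX; pose y := \sum_i v 0 i *: X i.
have LZ i : L (v 0 i *: X i) by exact: vnaZ.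
suff -> : (v *m density_mx tau X *m v^t*) 0 0 = tau (adj y * y).
  by apply: (trace_pos htau); apply: vna_sum => i _.
rewrite /y adj_sum // mulr_suml trace_sum; last first.
  move=> j _; apply: (vna_mul hL); first exact: vna_adjL.
  by apply: vna_sum => i _.
rewrite mxE; apply: eq_bigr => j _; rewrite mxE mulr_suml mulr_sumr trace_sum; last first.
  by move=> i _; apply: (vna_mul hL); first exact: vna_adjL.
apply: eq_bigr => i _; rewrite !mxE adjZ // bop_mulZZ traceZ; last first.
  by apply: (vna_mul hL); first exact: vna_adjL.
by rewrite mulrC mulrA.
Qed.

End VonNeumann.

(** * Operators on the tensor product as matrices *)

Section Tensor.
Context {R : realType} {H : sepHilbert R} {n : nat}.
Implicit Types (a b : 'M[R[i]]_n) (S T : bop H).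

Lemma tensM a b S T : tens a S *m tens b T = tens (a *m b) (S * T).
Proof.
apply/matrixP => i j; rewrite !mxE scaler_suml.
by apply: eq_bigr => k _; rewrite !mxE bop_mulZZ.
Qed.

Lemma tens1 : tens (1%:M : 'M[R[i]]_n) (1 : bop H) = 1%:M.
Proof.
by apply/matrixP => i j; rewrite !mxE; case: eqP => _; rewrite ?scale1r ?scale0r.
Qed.

Context {L : set (bop H)}.
Hypothesis hL : von_neumann_algebra L.

Definition mx_in (x : 'M[bop H]_n) := forall i j, L (x i j).

Lemma mx_in_tens a T : L T -> mx_in (tens a T).
Proof. by move=> LT i j; rewrite mxE; exact: (vnaZ hL). Qed.

Lemma mx_in_mul x y : mx_in x -> mx_in y -> mx_in (x *m y).
Proof.
by move=> Lx Ly i j; rewrite mxE; apply: (vna_sum hL) => k _; exact: (vna_mul hL).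
Qed.

Lemma mx_in_sum I (r : seq I) (P : pred I) (F : I -> 'M[bop H]_n) :
  (forall i, P i -> mx_in (F i)) -> mx_in (\sum_(i <- r | P i) F i).
Proof.
by move=> LF i j; rewrite summxE; apply: (vna_sum hL) => k Pk; exact: LF.
Qed.

Lemma mx_in_adj x : mx_in x -> mx_in (adjmx x).
Proof. by move=> Lx i j; rewrite mxE; exact: (vna_adjL hL). Qed.

Lemma adjmx_tens a T : L T -> adjmx (tens a T) = tens (a^t*) (adj T).
Proof. by move=> LT; apply/matrixP => i j; rewrite !mxE (adjZ hL). Qed.

Lemma adjmx_sum I (r : seq I) (P : pred I) (F : I -> 'M[bop H]_n) :
  (forall i, P i -> mx_in (F i)) ->
  adjmx (\sum_(i <- r | P i) F i) = \sum_(i <- r | P i) adjmx (F i).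
Proof.
move=> LF; apply/matrixP => i j; rewrite mxE !summxE (adj_sum hL).
  by apply: eq_bigr => k _; rewrite mxE.
by move=> k Pk; exact: LF.
Qed.

Context {tau : bop H -> R[i]}.
Hypothesis htau : faithful_normal_tracial_state L tau.

Lemma tens_trace_tens a T : L T -> tens_trace tau (tens a T) = n%:R^-1 * \tr a * tau T.
Proof.
move=> LT; rewrite /tens_trace /mxtrace -mulrA mulr_suml; congr (_ * _).
by apply: eq_bigr => i _; rewrite mxE (traceZ hL htau).
Qed.

Lemma tens_trace_sum I (r : seq I) (P : pred I) (F : I -> 'M[bop H]_n) :
  (forall i, P i -> mx_in (F i)) ->
  tens_trace tau (\sum_(i <- r | P i) F i) = \sum_(i <- r | P i) tens_trace tau (F i).
Proof.
move=> LF; rewrite -mulr_sumr; congr (_ * _); rewrite exchange_big /=.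
apply: eq_bigr => i _; rewrite summxE (trace_sum hL htau) // => k Pk; exact: LF.
Qed.

(** The sum over both indices of [tau (x i j * y j i)] is symmetric in [x] and [y]. *)
Lemma tens_traceC x y : mx_in x -> mx_in y ->
  tens_trace tau (x *m y) = tens_trace tau (y *m x).
Proof.
move=> Lx Ly; congr (_ * _).
have trE z w : mx_in z -> mx_in w -> \sum_i tau ((z *m w) i i) =
    \sum_i \sum_j tau (z i j * w j i).
  move=> Lz Lw; apply: eq_bigr => i _; rewrite mxE (trace_sum hL htau) // => j _.
  exact: (vna_mul hL).
rewrite !trE // exchange_big; apply: eq_bigr => i _; apply: eq_bigr => j _.
exact: (trace_tracial htau).
Qed.

Lemma tens1_inj : injective (fun a => tens a (1 : bop H)).
Proof.
move=> a b /matrixP ab; apply/matrixP => i j; have := ab i j; rewrite !mxE.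
move=> /(congr1 tau); rewrite !(traceZ hL htau); try exact: (vna_unit hL).
by rewrite (trace_unit htau) !mulr1.
Qed.

End Tensor.

(** * Double indices *)

Lemma index_pair_bij n :
  bijective (fun m : 'I_(n ^ 2) => (row_index m, col_index m)).
Proof.
apply: inj_card_bij; last by rewrite card_prod !card_ord -mulnn.
move=> m m' [] rm cm; apply/val_inj.
by rewrite /= (divn_eq m n) (divn_eq m' n) rm cm.
Qed.

Lemma index_pairK n (i j : 'I_n) :
  exists m : 'I_(n ^ 2), row_index m = i /\ col_index m = j.
Proof.
have [g _ gK] := index_pair_bij n; exists (g (i, j)).
by have [] := gK (i, j).
Qed.

Lemma index_pair_eq n (m m' : 'I_(n ^ 2)) :
  (m == m') = (row_index m == row_index m') && (col_index m == col_index m').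
Proof.
by rewrite -xpair_eqE (inj_eq (bij_inj (index_pair_bij n)) m m').
Qed.

Lemma sum_index_pair (V : nmodType) n (F : 'I_n -> 'I_n -> V) :
  \sum_(m < n ^ 2) F (row_index m) (col_index m) = \sum_i \sum_j F i j.
Proof.
rewrite pair_bigA /= (reindex (fun m : 'I_(n ^ 2) => (row_index m, col_index m))) //.
by apply: onW_bij; exact: index_pair_bij.
Qed.

(** * Linear forms *)

Section ScalarForms.
Context {C : comNzRingType} {V : lmodType C}.

Lemma scalar_bigsum I (r : seq I) (P : pred I) (f : I -> V -> C) :
  (forall i, scalar (f i)) -> scalar (fun x => \sum_(i <- r | P i) f i x).
Proof.
move=> fl a x y; rewrite mulr_sumr -big_split.
by apply: eq_bigr => i _; rewrite fl.
Qed.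

Lemma scalarMl (c : C) (f : V -> C) : scalar f -> scalar (fun x => c * f x).
Proof. by move=> fl a x y; rewrite fl mulrDr mulrCA. Qed.

Lemma scalarMr (c : C) (f : V -> C) : scalar f -> scalar (fun x => f x * c).
Proof. by move=> fl a x y; rewrite fl mulrDl mulrA. Qed.

Lemma scalar0 (f : V -> C) : scalar f -> f 0 = 0.
Proof. by move=> fl; have := fl (-1) 0 0; rewrite scaler0 addr0 mulN1r addNr. Qed.

Lemma scalarZ (f : V -> C) a x : scalar f -> f (a *: x) = a * f x.
Proof. by move=> fl; rewrite -[_ *: _]addr0 fl scalar0 // addr0. Qed.

Lemma scalar_sum (f : V -> C) I (r : seq I) (P : pred I) (F : I -> V) :
  scalar f -> f (\sum_(i <- r | P i) F i) = \sum_(i <- r | P i) f (F i).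
Proof.
move=> fl; apply: (big_morph f) => [x y|]; last exact: scalar0.
by have := fl 1 x y; rewrite scale1r mul1r.
Qed.

Lemma sum_delta (I : finType) (i0 : I) (F : I -> C) :
  \sum_i (i == i0)%:R * F i = F i0.
Proof.
rewrite (bigD1 i0) //= eqxx mul1r big1 ?addr0 // => i /negPf ->.
by rewrite mul0r.
Qed.

End ScalarForms.

(** * Matrix units *)

Section MatrixUnits.
Context {R : realType} {n : nat} {e : 'I_n -> 'I_n -> 'M[R[i]]_n}.
Hypothesis he : matrix_units e.

Lemma matrix_unitsM i j k l : e i j *m e k l = (j == k)%:R *: e i l.
Proof. by have [] := he. Qed.

(** All [e i i] have the same trace, as [e i j] and [e j i] multiply to either
    [e i i] or [e j j]; the common value is 1 since they sum to the identity. *)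
Lemma matrix_units_tr i j : \tr (e i j) = (i == j)%:R.
Proof.
have [n0|n_gt0] := posnP n; first by subst n; case: i.
have eM k l m : e k l = e k m *m e m l by rewrite matrix_unitsM eqxx scale1r.
have trd k : \tr (e k k) = \tr (e i i) by rewrite (eM k k i) mxtrace_mulC -eM.
have tri : \tr (e i i) = 1.
  have [_ _ /(congr1 mxtrace)] := he.
  rewrite raddf_sum mxtrace1 /= (eq_bigr (fun=> \tr (e i i))); last by move=> k _; rewrite trd.
  rewrite sumr_const card_ord => trn; apply: (@mulIf _ n%:R).
    by rewrite pnatr_eq0 -lt0n.
  by rewrite mulr_natr mul1r.
have [<-//|/negPf nij] := eqVneq i j.
by rewrite (eM i j i) mxtrace_mulC matrix_unitsM eq_sym nij scale0r mxtrace0.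
Qed.

(** The [e j i] are dual to the [e i j] for the trace pairing. Hence the matrix
    [G] whose rows list the entries of the [e i j] has as right inverse the
    matrix [G'] whose columns list those of the [e j i]. Both are square of size
    [n ^ 2], so [G'] is also a left inverse, and this second identity is the
    expansion. *)
Lemma matrix_units_expand (x : 'M[R[i]]_n) :
  x = \sum_i \sum_j \tr (x *m e j i) *: e i j.
Proof.
pose G := \matrix_(p < n ^ 2, q < n ^ 2)
  e (row_index p) (col_index p) (row_index q) (col_index q).
pose G' := \matrix_(q < n ^ 2, p < n ^ 2)
  e (col_index p) (row_index p) (col_index q) (row_index q).
have GG' : G *m G' = 1%:M.
  apply/matrixP => p p'; rewrite !mxE.
  transitivity (\tr (e (row_index p) (col_index p) *m e (col_index p') (row_index p'))).
    rewrite /mxtrace; under [RHS]eq_bigr do rewrite mxE.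
    rewrite -(sum_index_pair (fun r c =>
      e (row_index p) (col_index p) r c * e (col_index p') (row_index p') c r)).
    by apply: eq_bigr => q _; rewrite !mxE.
  rewrite matrix_unitsM linearZ /= matrix_units_tr -natrM mulnb index_pair_eq.
  by rewrite andbC.
have /matrixP G'G := mulmx1C GG'.
apply/matrixP => r' c'; have [q' [<- <-]] := index_pairK r' c'.
rewrite summxE; under eq_bigr do rewrite summxE.
(* [q] runs over the entries of [x] in the trace; summing over [i] and [j]
   first gives the entry of [G' *m G] at [q] and [q']. *)
transitivity (\sum_i \sum_j \sum_(q < n ^ 2) x (row_index q) (col_index q) *
    (e j i (col_index q) (row_index q) * e i j (row_index q') (col_index q'))).
  rewrite -(sum_index_pair (fun i j => \sum_(q < n ^ 2) x (row_index q) (col_index q) *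
    (e j i (col_index q) (row_index q) * e i j (row_index q') (col_index q')))).
  rewrite exchange_big /= (bigD1 q') //= [X in _ + X]big1 ?addr0.
    rewrite -mulr_sumr; have := G'G q' q'; rewrite !mxE eqxx.
    under eq_bigr do rewrite !mxE.
    by move=> ->; rewrite mulr1.
  move=> q /negPf qq'; rewrite -mulr_sumr; have := G'G q q'; rewrite !mxE qq'.
  under eq_bigr do rewrite !mxE.
  by move=> ->; rewrite mulr0.
apply: eq_bigr => i _; apply: eq_bigr => j _; rewrite mxE mulr_suml.
under eq_bigr do rewrite mulrA.
rewrite -mulr_suml -mulr_suml; congr (_ * _).
rewrite (sum_index_pair (fun r c => x r c * e j i c r)).
by apply: eq_bigr => r _; rewrite mxE.
Qed.

Lemma matrix_units_ext (f g : 'M[R[i]]_n -> R[i]) : scalar f -> scalar g ->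
  (forall i j, f (e i j) = g (e i j)) -> f =1 g.
Proof.
move=> fl gl fg x; rewrite [x]matrix_units_expand.
rewrite !scalar_sum //; apply: eq_bigr => i _.
by rewrite !scalar_sum //; apply: eq_bigr => j _; rewrite !scalarZ // fg.
Qed.

End MatrixUnits.

(** * The correlation form of N and its conjugate *)

Section Correlation.
Context {R : realType} {H : sepHilbert R} {n : nat} {L : set (bop H)}.
Context {tau : bop H -> R[i]} {e : 'I_n -> 'I_n -> 'M[R[i]]_n}.
Context {u : 'M[bop H]_n} {u_ : 'I_n -> 'I_n -> bop H}.
Hypotheses (n_gt0 : (1 <= n)%N) (hL : von_neumann_algebra L).
Hypotheses (htau : faithful_normal_tracial_state L tau) (he : matrix_units e).
Hypotheses (hu : unitary_op u) (hu_L : forall i j, L (u_ i j)).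
Hypothesis hu_ : u = \sum_(i < n) \sum_(j < n) tens (e i j) (u_ i j).
Implicit Types x y : 'M[R[i]]_n.

Let L1 := vna_unit hL.
Let mx_in_u : mx_in (L := L) u.
Proof.
rewrite hu_; apply: (mx_in_sum hL) => i _; apply: (mx_in_sum hL) => j _.
exact: (mx_in_tens hL).
Qed.

Let adjmx_u : adjmx u = \sum_k \sum_l tens (e l k) (adj (u_ k l)).
Proof.
rewrite hu_ (adjmx_sum hL) => [|i _]; last first.
  by apply: (mx_in_sum hL) => j _; exact: (mx_in_tens hL).
apply: eq_bigr => i _; rewrite (adjmx_sum hL) => [|j _]; last exact: (mx_in_tens hL).
apply: eq_bigr => j _; rewrite (adjmx_tens hL) //.
by have [_ -> _] := he.
Qed.

Definition correlation x y :=
  tens_trace tau (tens x 1 *m (u *m tens y 1 *m adjmx u)).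

(** Once [u] is expanded along the matrix units, the operators enter only
    through the numbers [tau (u_ i j * adj (u_ k l))], and bilinearity becomes a
    fact about traces of complex matrices. *)
Lemma correlationE x y : correlation x y =
  n%:R^-1 * \sum_i \sum_j \sum_k \sum_l
    \tr (x *m e i j *m y *m e l k) * tau (u_ i j * adj (u_ k l)).
Proof.
have LL i j k l : L (u_ i j * adj (u_ k l)).
  by apply: (vna_mul hL) => //; exact: (vna_adjL hL).
transitivity (tens_trace tau (\sum_i \sum_j \sum_k \sum_l
    tens (x *m e i j *m y *m e l k) (u_ i j * adj (u_ k l)))).
  congr tens_trace; rewrite {1}hu_ !mulmxA mulmx_sumr !mulmx_suml.
  apply: eq_bigr => i _; rewrite mulmx_sumr !mulmx_suml; apply: eq_bigr => j _.
  rewrite adjmx_u mulmx_sumr; apply: eq_bigr => k _; rewrite mulmx_sumr; apply: eq_bigr => l _.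
  by rewrite !tensM mul1r mulr1.
rewrite mulr_sumr (tens_trace_sum hL htau); last first.
  by move=> i _; do 3![apply: (mx_in_sum hL) => ? _]; exact: (mx_in_tens hL).
apply: eq_bigr => i _; rewrite mulr_sumr (tens_trace_sum hL htau); last first.
  by move=> j _; do 2![apply: (mx_in_sum hL) => ? _]; exact: (mx_in_tens hL).
apply: eq_bigr => j _; rewrite mulr_sumr (tens_trace_sum hL htau); last first.
  by move=> k _; apply: (mx_in_sum hL) => ? _; exact: (mx_in_tens hL).
apply: eq_bigr => k _; rewrite mulr_sumr (tens_trace_sum hL htau); last first.
  by move=> l _; exact: (mx_in_tens hL).
by apply: eq_bigr => l _; rewrite (tens_trace_tens hL htau) // mulrA.
Qed.

Lemma correlation_linearl y : scalar (correlation^~ y).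
Proof.
move=> a x x'; rewrite !correlationE; move: a x x'; apply: scalarMl.
do 4![apply: scalar_bigsum => ?]; apply: scalarMr => a x x'.
by rewrite !mulmxDl -!scalemxAl linearP.
Qed.

Lemma correlation_linearr x : scalar (correlation x).
Proof.
move=> a y y'; rewrite !correlationE; move: a y y'; apply: scalarMl.
do 4![apply: scalar_bigsum => ?]; apply: scalarMr => a y y'.
by rewrite mulmxDr mulmxDl -scalemxAr -scalemxAl linearP.
Qed.

(** Between matrix units a single term of the expansion survives: the product of
    [e a b], [e i j], [e c d] and [e l k] has nonzero trace only for [i = b],
    [j = c], [l = d] and [k = a]. *)
Lemma correlation_matrix_units a b c d :
  correlation (e a b) (e c d) = n%:R^-1 * tau (u_ b c * adj (u_ a d)).
Proof.
rewrite correlationE; congr (_ * _).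
transitivity (\sum_i (i == b)%:R * \sum_j (j == c)%:R *
    \sum_k (k == a)%:R * \sum_l (l == d)%:R * tau (u_ i j * adj (u_ k l))).
  apply: eq_bigr => i _; rewrite mulr_sumr; apply: eq_bigr => j _.
  rewrite !mulr_sumr; apply: eq_bigr => k _; rewrite !mulr_sumr; apply: eq_bigr => l _.
  do 3![rewrite !(matrix_unitsM he) -?scalemxAl]; rewrite !linearZ /= (matrix_units_tr he).
  by rewrite (eq_sym b) (eq_sym d) (eq_sym a); ring.
by rewrite !sum_delta.
Qed.

Lemma correlation1l y : correlation 1%:M y = n%:R^-1 * \tr y.
Proof.
have [uu _] := hu; have Ly : mx_in (L := L) (tens y 1) by exact: (mx_in_tens hL).
rewrite /correlation tens1 mul1mx (tens_traceC hL htau); first last.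
- exact: (mx_in_adj hL).
- exact: (mx_in_mul hL).
by rewrite mulmxA uu mul1mx (tens_trace_tens hL htau) // (trace_unit htau) mulr1.
Qed.

Lemma correlation1r x : correlation x 1%:M = n%:R^-1 * \tr x.
Proof.
have [_ uu] := hu; rewrite /correlation tens1 mulmx1 uu mulmx1.
by rewrite (tens_trace_tens hL htau) // (trace_unit htau) mulr1.
Qed.

(** Orthogonality only constrains arguments of trace zero; it is applied to [x]
    and [y] minus their normalized traces, and the cross terms are known since
    one of their arguments is scalar. *)
Lemma mutually_orthogonalP :
  mutually_orthogonal (tens_trace tau) (@mx_factor R H n) (conj_set u (@mx_factor R H n))
  <-> forall x y, correlation x y = (n%:R^-1 * \tr x) * (n%:R^-1 * \tr y).
Proof.
have tr_tens x : tens_trace tau (tens x 1) = n%:R^-1 * \tr x.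
  by rewrite (tens_trace_tens hL htau) // (trace_unit htau) mulr1.
have tr_conj y : tens_trace tau (u *m tens y 1 *m adjmx u) = n%:R^-1 * \tr y.
  by rewrite -correlation1l /correlation tens1 mul1mx.
have n0 : n%:R != 0 :> R[i] by rewrite pnatr_eq0 -lt0n.
split=> [orth x y|fact _ _ [x _ <-] [_ [y _ <-] <-]]; last first.
  rewrite tr_tens tr_conj => x0 _; rewrite -/(correlation x y) fact x0.
  by rewrite mul0r.
set s := n%:R^-1 * \tr x; set t := n%:R^-1 * \tr y.
have centred (z : 'M[R[i]]_n) : n%:R^-1 * \tr (- (n%:R^-1 * \tr z) *: 1%:M + z) = 0.
  by rewrite mxtraceD mxtraceZ mxtrace1 mulrDr mulrCA mulVf // mulr1 addNr.
have : correlation (- s *: 1%:M + x) (- t *: 1%:M + y) = 0.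
  apply: orth; rewrite ?tr_tens ?tr_conj ?centred //; first by exists (- s *: 1%:M + x).
  by exists (tens (- t *: 1%:M + y) 1) => //; exists (- t *: 1%:M + y).
rewrite correlation_linearl !correlation_linearr !correlation1l correlation1r.
rewrite mxtrace1 mulVf // -/s -/t !mulr1 => /eqP.
by rewrite addNr mulr0 add0r mulNr addrC subr_eq0 => /eqP ->; rewrite mulrC.
Qed.

Let rho := density_mx tau (induced_partition u_).

Let partition_in m : L (induced_partition u_ m).
Proof. exact: (vnaZ hL). Qed.

(** With [m] the pair (b, c) and [m'] the pair (a, d), this is the value of the
    correlation form at [e a b] and [e c d]. *)
Lemma density_induced m m' : rho m m' = n%:R^-1 *
  tau (u_ (row_index m) (col_index m) * adj (u_ (row_index m') (col_index m'))).
Proof.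
have La i j : L (adj (u_ i j)) by exact: (vna_adjL hL).
rewrite mxE /induced_partition (adjZ hL) // bop_mulZZ (traceZ hL htau); last first.
  exact: (vna_mul hL).
rewrite (trace_tracial htau) //; congr (_ * _).
rewrite fmorphV /= (conj_Creal (sqrtC_real _)) ?ler0n //.
by rewrite -invfM -expr2 sqrtCK.
Qed.

Lemma mutually_orthogonal_density :
  mutually_orthogonal (tens_trace tau) (@mx_factor R H n) (conj_set u (@mx_factor R H n))
  <-> (n ^ 2)%:R *: rho = 1%:M.
Proof.
have n0 : n%:R != 0 :> R[i] by rewrite pnatr_eq0 -lt0n.
rewrite mutually_orthogonalP; split=> [fact|rho1].
  apply/matrixP => m m'; rewrite mxE density_induced -correlation_matrix_units fact.
  rewrite !(matrix_units_tr he) !mxE index_pair_eq -mulnb natrX natrM expr2.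
  rewrite (eq_sym (row_index m')); field.
  exact: n0.
have fact a b c d : correlation (e a b) (e c d) =
    (n%:R^-1 * \tr (e a b)) * (n%:R^-1 * \tr (e c d)).
  have [m [<- <-]] := index_pairK b c; have [m' [<- <-]] := index_pairK a d.
  have /matrixP/(_ m m') := rho1.
  rewrite correlation_matrix_units -density_induced mxE [RHS]mxE index_pair_eq => rhoE.
  rewrite !(matrix_units_tr he) (eq_sym (row_index m')) mulrACA -natrM mulnb -rhoE.
  by rewrite natrX; field; exact: n0.
move=> x y.
have fl : scalar (fun x : 'M[R[i]]_n => n%:R^-1 * \tr x).
  by apply: scalarMl => a v w; rewrite linearP.
apply: (matrix_units_ext he (f := correlation^~ y)
  (g := fun x => (n%:R^-1 * \tr x) * (n%:R^-1 * \tr y))) => [||a b].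
- exact: correlation_linearl.
- exact: scalarMr.
apply: (matrix_units_ext he (f := correlation (e a b))
  (g := fun y => (n%:R^-1 * \tr (e a b)) * (n%:R^-1 * \tr y))) => //.
- exact: correlation_linearr.
- exact: scalarMl.
Qed.

(** The diagonal entry of [rho] at the pair (i, j) is the correlation of [e i i]
    and [e j j]; these matrix units sum to the identity, so the trace is the
    correlation of the identity with itself. *)
Lemma trace_density : \tr rho = 1.
Proof.
have n0 : n%:R != 0 :> R[i] by rewrite pnatr_eq0 -lt0n.
transitivity (correlation (\sum_i e i i) (\sum_j e j j)).
  rewrite (scalar_sum _ _ _ (correlation_linearl _)).
  rewrite /mxtrace (eq_bigr (fun m : 'I_(n ^ 2) => (fun i j : 'I_n =>
    correlation (e i i) (e j j)) (row_index m) (col_index m))); last first.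
    by move=> m _; rewrite density_induced correlation_matrix_units.
  rewrite (sum_index_pair (fun i j : 'I_n => correlation (e i i) (e j j))).
  apply: eq_bigr => i _.
  by rewrite (scalar_sum _ _ _ (correlation_linearr _)).
by have [_ _ ->] := he; rewrite correlation1r mxtrace1 mulVf.
Qed.


End Correlation.

(** * Spectrum of a positive matrix *)

Section Positive.
Context {C : numClosedFieldType} {k : nat} {A : 'M[C]_k}.
Hypothesis A_ge0 : forall v : 'rV[C]_k, 0 <= (v *m A *m v^t*) 0 0.

(** Polarization: a form that is real on the diagonal is hermitian, as seen by
    evaluating it at [x + y] and at [x + 'i *: y]. *)
Lemma psd_hermitian : A^t* = A.
Proof.
pose q (u v : 'rV[C]_k) := form Num.conj A u v.
have qr v : Num.conj (q v v) = q v v by apply/conj_Creal/ger0_real/A_ge0.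
apply/matrixP => i j; rewrite !mxE -!(formee Num.conj A) -!/(q _ _).
set x := 'e_i; set y := 'e_j.
have := qr (x + y); have := qr (x + 'i *: y).
rewrite /q !(formDl, formDr, formZl, formZr) -!/(q _ _) !(rmorphD, rmorphM) /=.
rewrite !conjCi !rmorphN /= conjCi !qr => E1 E2.
(* [E1] comes from [x + 'i *: y]; it yields the real part of the wanted
   equality, times ['i], and [E2], from [x + y], yields the imaginary part. *)
have E1' : 'i * (Num.conj (q x y) - q y x + q x y - Num.conj (q y x)) = 0.
  have -> : 'i * (Num.conj (q x y) - q y x + q x y - Num.conj (q y x)) =
   (q x x + - - 'i * Num.conj (q x y) + (- 'i * Num.conj (q y x) + - 'i * (- - 'i * q y y)))
   - (q x x + - 'i * q x y + ('i * q y x + 'i * (- 'i * q y y))) by ring.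
  by rewrite E1 subrr.
have {E1'}E1 : Num.conj (q x y) - q y x + q x y - Num.conj (q y x) = 0.
  by move/eqP: E1'; rewrite mulf_eq0 (negPf (neq0Ci _)) => /eqP.
have {}E2 : Num.conj (q x y) = q x y + q y x - Num.conj (q y x).
  have -> : Num.conj (q x y) = q x x + Num.conj (q x y) + (Num.conj (q y x) + q y y)
    - (q x x + q y y + Num.conj (q y x)) by ring.
  by rewrite E2; ring.
have : (q x y - Num.conj (q y x)) *+ 2 = 0.
  by rewrite -[RHS]E1 E2; ring.
by move=> /eqP; rewrite mulrn_eq0 /= subr_eq0 => /eqP <-.
Qed.

Lemma psd_spectralE : A = invmx (spectralmx A) *m diag_mx (spectral_diag A) *m spectralmx A.
Proof. by apply/orthomx_spectralP/normalmxP; rewrite psd_hermitian. Qed.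

Lemma psd_diag_mxE : diag_mx (spectral_diag A) = spectralmx A *m A *m invmx (spectralmx A).
Proof.
rewrite [X in _ *m X *m _]psd_spectralE !mulmxA mulmxV ?spectral_unit // mul1mx.
by rewrite mulmxK ?spectral_unit.
Qed.

(** An eigenvalue is the quadratic form at the corresponding row of the unitary
    that diagonalizes [A]. *)
Lemma psd_spectral_ge0 i : 0 <= spectral_diag A 0 i.
Proof.
have := A_ge0 (row i (spectralmx A)).
suff -> : (row i (spectralmx A) *m A *m (row i (spectralmx A))^t*) 0 0 =
  (diag_mx (spectral_diag A)) i i by rewrite mxE eqxx mulr1n.
rewrite psd_diag_mxE invmx_unitary ?spectral_unitarymx // -row_mul mxE [RHS]mxE.
by apply: eq_bigr => j _; rewrite !mxE.
Qed.

Lemma psd_scalarP (c : C) : (forall i, spectral_diag A 0 i = c) <-> A = c%:M.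
Proof.
split=> [spc|Ac i].
  rewrite psd_spectralE; have -> : diag_mx (spectral_diag A) = c%:M.
    by apply/matrixP => i j; rewrite !mxE spc.
  by rewrite scalar_mxC mulmxKV ?spectral_unit.
have /matrixP/(_ i i) := psd_diag_mxE; rewrite [X in _ *m X *m _]Ac.
by rewrite scalar_mxC mulmxK ?spectral_unit // !mxE eqxx !mulr1n.
Qed.

Lemma psd_trace : \tr A = \sum_i spectral_diag A 0 i.
Proof.
by rewrite {1}psd_spectralE mxtrace_mulC mulmxA mulmxV ?spectral_unit // mul1mx mxtrace_diag.
Qed.

End Positive.

(** * The maximum of the entropy *)

Section Entropy.
Context {R : realType}.

(** The right hand side is the tangent to [eta] at [k^-1]. For [t > 0] the
    inequality is [1 + y < expR y] at [y = ln ((k * t)^-1)], multiplied by [t]. *)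
Lemma eta_lt_tangent (k : R) t : 0 < k -> 0 <= t -> t != k^-1 ->
  eta t < t * ln k + k^-1 - t.
Proof.
move=> k0; rewrite le_eqVlt => /orP[/eqP<- _|t0 tk].
  by rewrite /eta ltxx mul0r add0r subr0 invr_gt0.
have kt : 0 < (k * t)^-1 by rewrite invr_gt0 mulr_gt0.
rewrite /eta t0.
have lnkt : ln (k * t)^-1 = - (ln k + ln t).
  by rewrite lnV ?posrE ?mulr_gt0 // lnM ?posrE.
have : 1 + ln (k * t)^-1 < (k * t)^-1.
  rewrite -[X in _ < X]lnK ?posrE //; apply: expR_gt1Dx.
  rewrite ln_eq0 // invr_eq1; apply: contraNneq tk => kt1.
  by rewrite -[t](mulKf (lt0r_neq0 k0)) kt1 mulr1.
rewrite lnkt -(ltr_pM2l t0) invfM mulrCA divff ?lt0r_neq0 // mulr1.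
lra.
Qed.

Lemma eta_inv (k : R) : 0 < k -> eta k^-1 = k^-1 * ln k.
Proof. by move=> k0; rewrite /eta invr_gt0 k0 lnV ?posrE // mulNr mulrN opprK. Qed.

(** The tangent inequalities add up to the bound [ln k], which would be strict
    if one of them were. *)
Lemma sum_eta_max k (p : 'I_k -> R) : (0 < k)%N -> (forall i, 0 <= p i) ->
  \sum_i p i = 1 -> \sum_i eta (p i) = ln k%:R -> forall i, p i = k%:R^-1.
Proof.
move=> k_gt0 p0 p1 max i; apply/eqP/negP => /negP pi.
have k0 : (0 : R) < k%:R by rewrite ltr0n.
have le_tangent j : eta (p j) <= p j * ln k%:R + k%:R^-1 - p j.
  have [->|pj] := eqVneq (p j) k%:R^-1; last exact/ltW/eta_lt_tangent.
  by rewrite eta_inv // addrK.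
have : \sum_j eta (p j) < \sum_j (p j * ln k%:R + k%:R^-1 - p j).
  rewrite (bigD1 i) // [ltRHS](bigD1 i) //=; apply: ltr_leD.
    exact: eta_lt_tangent.
  exact: ler_sum.
rewrite max sumrB big_split /= -mulr_suml p1 mul1r sumr_const card_ord.
by rewrite -[X in _ + X - 1]mulr_natl divff ?lt0r_neq0 // addrK ltxx.
Qed.

Lemma entropy_spectral k (A : 'M[R[i]]_k) :
  entropy A = (\sum_i eta (complex.Re (spectral_diag A 0 i)))%:C.
Proof.
rewrite /entropy /mx_fun mxtrace_mulC mulmxA mulmxV ?spectral_unit // mul1mx.
by rewrite mxtrace_diag rmorph_sum; apply: eq_bigr => i _; rewrite mxE.
Qed.

Lemma complex_ge0_Re (z : R[i]) : 0 <= z -> z = (complex.Re z)%:C.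
Proof. by case: z => a b; rewrite lecE /= => /andP[/eqP-> _]. Qed.

Lemma entropy_max k (A : 'M[R[i]]_k) : (0 < k)%N ->
  (forall v : 'rV[R[i]]_k, 0 <= (v *m A *m v^t*) 0 0) -> \tr A = 1 ->
  entropy A = (ln (k%:R : R))%:C <-> k%:R *: A = 1%:M.
Proof.
move=> k_gt0 A0 trA.
have k0 : (0 : R) < k%:R by rewrite ltr0n.
have kc0 : k%:R != 0 :> R[i] by rewrite pnatr_eq0 -lt0n.
have kcE : (k%:R : R[i])^-1 = ((k%:R : R)^-1)%:C by rewrite fmorphV rmorph_nat.
set p := fun i => complex.Re (spectral_diag A 0 i).
have spE i : spectral_diag A 0 i = (p i)%:C.
  by apply: complex_ge0_Re; exact: psd_spectral_ge0.
have -> : (k%:R *: A = 1%:M) <-> A = (k%:R^-1)%:M.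
  split=> [kA|->]; last by rewrite scale_scalar_mx divff.
  by apply: (scalerI kc0); rewrite kA scale_scalar_mx divff.
rewrite -(psd_scalarP A0) entropy_spectral; split=> [/complexI max i|sp].
  rewrite spE kcE; congr (_%:C); apply: sum_eta_max => //.
    by move=> j; have := psd_spectral_ge0 A0 j; rewrite spE lecR.
  apply: (@complexI R); rewrite rmorph_sum rmorph1 -trA (psd_trace A0).
  by apply: eq_bigr => j _; rewrite spE.
have pE i : p i = k%:R^-1.
  by apply: (@complexI R); rewrite -spE sp kcE.
congr (_%:C); rewrite (eq_bigr (fun=> k%:R^-1 * ln k%:R)).
  by rewrite sumr_const card_ord -[LHS]mulr_natl mulrA divff ?lt0r_neq0 // mul1r.
by move=> i _; rewrite -/(p i) pE eta_inv.
Qed.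

End Entropy.

(** * Dimension of the factor *)

Section Dimension.
Context {R : realType} {H : sepHilbert R} {n : nat} {L : set (bop H)}.
Context {tau : bop H -> R[i]}.
Hypotheses (hL : von_neumann_algebra L) (htau : faithful_normal_tracial_state L tau).

(** Elementary matrices tensored with 1 are independent because [tau 1 = 1], so
    that no nonzero multiple of the unit operator vanishes. *)
Lemma mx_factor_dim : has_dim (@mx_factor R H n) (n ^ 2).
Proof.
pose b (m : 'I_(n ^ 2)) : 'M[bop H]_n :=
  tens (delta_mx (row_index m) (col_index m)) 1.
pose coef (c : {ffun 'I_(n ^ 2) -> R[i]}) : 'M[R[i]]_n :=
  \sum_m c m *: delta_mx (row_index m) (col_index m).
have coefE c m : coef c (row_index m) (col_index m) = c m.
  rewrite summxE (bigD1 m) //= !mxE !eqxx mulr1 big1 ?addr0 // => m' /negPf mm'.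
  by rewrite !mxE (eq_sym (row_index m)) (eq_sym (col_index m)) -index_pair_eq mm' mulr0.
have lincombE c : lincomb b c = tens (coef c) 1.
  apply/matrixP => i j; rewrite /lincomb !mxE !summxE scaler_suml.
  by apply: eq_bigr => m _; rewrite !mxE scalerA.
exists b => [c c'|].
  rewrite !lincombE => /(tens1_inj hL htau) cc'.
  by apply/ffunP => m; rewrite -!coefE cc'.
apply/seteqP; split=> [_ [a _ <-]|_ [c _ <-]]; last by rewrite lincombE; exists (coef c).
exists [ffun m => a (row_index m) (col_index m)] => //; rewrite lincombE; congr tens.
apply/matrixP => i j; have [m [<- <-]] := index_pairK i j.
by rewrite coefE ffunE.
Qed.

End Dimension.

(** * The three equivalent conditions *)

Unset Implicit Arguments.
Set Strict Implicit.

Theorem theorem3p3p5 (R : realType) (H : sepHilbert R) (n : nat) (hn : (1 <= n)%N)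
    (L : set (bop H)) (hL : von_neumann_algebra L) (hfin : finite_vna L)
    (tauL : bop H -> R[i]) (htau : faithful_normal_tracial_state L tauL)
    (e : 'I_n -> 'I_n -> 'M[R[i]]_n) (he : matrix_units e)
    (u : 'M[bop H]_n) (huM : tensor_algebra L u) (hu : unitary_op u)
    (u_ : 'I_n -> 'I_n -> bop H) (hu_L : forall i j, L (u_ i j))
    (hu_ : u = \sum_(i < n) \sum_(j < n) tens (e i j) (u_ i j)) :
  let tau := tens_trace tauL in
  let N := @mx_factor R H n in
  let rho := density_mx tauL (induced_partition u_) in
  (mutually_orthogonal tau N (conj_set u N) <-> (n ^ 2)%:R *: rho = 1%:M) /\
  ((n ^ 2)%:R *: rho = 1%:M <->
     entropy rho = (2 * ln (n%:R : R))%:C /\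
     exists2 d : nat, has_dim N d & 2 * ln (n%:R : R) = ln (d%:R : R)).
Proof.
rewrite /=; set rho := density_mx _ _.
have LU m : L (induced_partition u_ m) by exact: (vnaZ hL).
have ln2 : 2 * ln (n%:R : R) = ln ((n ^ 2)%:R : R).
  by rewrite natrX lnXn ?ltr0n // mulr_natl.
have rhoS : entropy rho = (2 * ln (n%:R : R))%:C <-> (n ^ 2)%:R *: rho = 1%:M.
  rewrite ln2; apply: entropy_max; first by rewrite expn_gt0 hn.
    by move=> v; exact: (density_mx_psd hL htau).
  exact: (trace_density hn hL htau he hu hu_L hu_).
split; first exact: (mutually_orthogonal_density hn hL htau he hu hu_L hu_).
split=> [rho1|[S _]]; last exact/rhoS.
split; first exact/rhoS.
by exists (n ^ 2)%N => //; exact: (mx_factor_dim hL htau).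
Qed.
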